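(* Let $Q$ be a (positive, not necessarily normalized) measure and let $X$ be a real-valued random variable (measurable function) with $E_{Q}(X)=0$, $E_{Q}(X^{2})=1$ and $E_{Q}(X^{3})>0$. If there exists $\beta<0$ such that $Z(\beta)=\int\exp(\beta X)\,\mathrm{d}Q<\infty$, then there exists $\epsilon>0$ such that for all measures $P$ (not necessarily normalized) with $E_{P}(X)\in[-\epsilon,0]$ we have the inequality \[ D(P\Vert Q)\geq\frac{1}{2}\left(E_{P}(X)\right)^{2}. \]
   Context: For a measure $\nu$, $E_{\nu}(Y)=\int Y\,\mathrm{d}\nu$ (integral with respect to $\nu$, without normalization). Information divergence is extended from probability measures to general measures: for discrete measures $P=(p_i)$, $Q=(q_i)$, $D(P\Vert Q)=\sum_{i}\left(p_{i}\ln\frac{p_{i}}{q_{i}}-(p_{i}-q_{i})\right)$; in general, $D(P\Vert Q)=\int\left(\frac{\mathrm{d}P}{\mathrm{d}Q}\ln\frac{\mathrm{d}P}{\mathrm{d}Q}-\frac{\mathrm{d}P}{\mathrm{d}Q}+1\right)\mathrm{d}Q$ if $P$ is absolutely continuous with respect to $Q$, and $D(P\Vert Q)=\infty$ otherwise (with $0\ln 0=0$). *)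

(* Defs.v *)
From HB Require Import structures.
From mathcomp Require Import all_boot all_order all_algebra.
From mathcomp Require Import all_classical all_reals all_analysis.
From mathcomp Require Import measurable_realfun.

Set Implicit Arguments.
Unset Strict Implicit.
Unset Printing Implicit Defensive.

Import Order.TTheory GRing.Theory Num.Theory.
Import numFieldNormedType.Exports.

Local Open Scope classical_set_scope.
Local Open Scope ring_scope.
Local Open Scope ereal_scope.

Section divergence.
Context d (T : measurableType d) (R : realType).
Implicit Types P Q : {measure set T -> \bar R}.

(* The library's ['d nu '/d mu] requires nu to be a (finite) charge and mu to be
   sigma-finite. The measures P compared with Q here may be infinite, even not
   sigma-finite, so densities take values in [0, +oo]. *)
Definition is_density P Q (f : T -> \bar R) : Prop :=
  [/\ measurable_fun [set: T] f,
      forall x, 0 <= f x &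
      forall A, measurable A -> P A = \int[Q]_(x in A) f x].

(* dP/dQ. When Q is sigma-finite and P `<< Q, a density exists and is unique
   Q-almost everywhere; the value 0 is a default for the remaining cases. *)
Definition density P Q : T -> \bar R := xget (cst 0) [set f | is_density P Q f].

(* t ln t - t + 1, extended by its limit at +oo. At t = 0 the library's
   convention ln 0 = 0 gives 0 ln 0 = 0. The value at -oo is never used. *)
Definition div_integrand (t : \bar R) : \bar R :=
  match t with
  | r%:E => (r * ln r - r + 1)%R%:E
  | +oo => +oo
  | -oo => 0
  end.

Definition divergence P Q : \bar R :=
  if `[< P `<< Q >] then \int[Q]_x div_integrand (density P Q x) else +oo.

End divergence.

(* Main.v *)
Require Import Defs.
From HB Require Import structures.
From mathcomp Require Import all_boot all_order all_algebra.
From mathcomp Require Import all_classical all_reals all_analysis.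
From mathcomp Require Import measurable_realfun ring lra.
Import Order.TTheory GRing.Theory Num.Theory.
Import numFieldNormedType.Exports.
Local Open Scope classical_set_scope.
Local Open Scope ring_scope.

(* Young's inequality s t <= (t ln t - t + 1) + (e^s - 1), applied to t = dP/dQ
   and s = m X with m = E_P(X), gives
     D(P || Q) >= m^2 - int (e^(m X) - 1) dQ,
   so it suffices that int (e^(t X) - 1) dQ <= t^2 / 2 for t <= 0 near 0. With
   b = - t this says that the integral of
     phi_b(X) = (1 - b X + (b X)^2 / 2 - e^(- b X)) / b^3
   is nonnegative. For fixed X the quantity phi_b(X) increases to X^3 / 6 as b
   decreases to 0, so by monotone convergence its integral tends to
   E_Q(X^3) / 6 > 0 (possibly +oo). The exponential moment makes Q finite and
   phi_b(X) integrable for small b. *)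

(** * Inequalities for the exponential function *)

(** Two uses of the mean value theorem from 0 give f(y) = f2(e) c y with c between 0 and y and e
    between 0 and c; here c y >= 0 whatever the sign of y. *)
Lemma second_derivative_ge0 {R : realType} (f f1 f2 : R -> R) (A y : R) :
  (forall x : R, is_derive x 1 f (f1 x)) ->
  (forall x : R, is_derive x 1 f1 (f2 x)) ->
  (forall x, `|x| <= A -> 0 <= f2 x) ->
  f 0 = 0 -> f1 0 = 0 -> `|y| <= A -> 0 <= f y.
Proof.
move=> df df1 f2_ge0 f0 f10 yA.
have cont (g g1 : R -> R) (a b : R) : (forall x : R, is_derive x 1 g (g1 x)) ->
    {within `[a, b]%classic, continuous (g : R -> R)}.
  move=> dg; apply: continuous_subspaceT => x.
  by apply/differentiable_continuous/derivable1_diffP; have [] := dg x.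
have mvt (g g1 : R -> R) (z : R) :
    (forall x : R, is_derive x 1 g (g1 x)) -> g 0 = 0 ->
    exists2 c, `|c| <= `|z| /\ 0 <= c * z & g z = g1 c * z.
  move=> dg g0; have [z0|z0] := leP 0 z.
    have [c /[!in_itv]/= /andP[c0 cz] E] :=
      MVT_segment z0 (fun x _ => dg x) (cont _ _ _ _ dg).
    exists c; first by rewrite !ger0_norm// mulr_ge0.
    by move: E; rewrite g0 !subr0.
  have [c /[!in_itv]/= /andP[zc c0] E] :=
    MVT_segment (ltW z0) (fun x _ => dg x) (cont _ _ _ _ dg).
  exists c; first by rewrite !ler0_norm ?lerN2// ?(ltW z0)// mulr_le0// ltW.
  by move: E; rewrite g0 !sub0r mulrN => /oppr_inj.
have [c [cy cy0] ->] := mvt _ _ y df f0.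
have [e [ec ec0] ->] := mvt _ _ c df1 f10.
by rewrite -mulrA mulr_ge0// f2_ge0// (le_trans ec)// (le_trans cy).
Qed.

(** Up to sign, the second-order Taylor remainder of e^(-y) at 0, so it behaves as y^3 / 6 there;
    [exp_rem3 (b * x) / b ^+ 3] is phi_b(x). *)
Definition exp_rem3 {R : realType} (y : R) : R :=
  1 - y + y ^+ 2 / 2 - expR (- y).

(* Says that [b |-> exp_rem3 (b * x) / b ^+ 3] has nonpositive derivative. *)
Lemma expR_pade {R : realType} (y : R) :
  (y + 3) * expR (- y) <= 3 - y *+ 2 + y ^+ 2 / 2.
Proof.
rewrite -subr_ge0.
pose f (x : R) := 3 - x *+ 2 + x ^+ 2 / 2 - (x + 3) * expR (- x).
pose f1 (x : R) := x - 2 + (x + 2) * expR (- x).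
pose f2 (x : R) := 1 - (x + 1) * expR (- x).
(* The second derivative 1 - (x + 1) e^(-x) is nonnegative on the whole line, because 1 + x <=
   e^x. *)
apply: (@second_derivative_ge0 _ f f1 f2 `|y|) => //.
- by move=> x; apply: is_derive_eq; rewrite /GRing.scale /f1 /=; field.
- by move=> x; apply: is_derive_eq; rewrite /GRing.scale /f2 /=; field.
- move=> x _; rewrite /f2 expRN subr_ge0 ler_pdivrMr ?expR_gt0// mul1r addrC.
  exact: expR_ge1Dx.
- by rewrite /f oppr0 expR0; field.
- by rewrite /f1 oppr0 expR0; field.
Qed.

(** Monotonicity of phi_b in b, for x of either sign: by [expR_pade] the derivative [F'] is
    nonpositive at every t > 0. *)
Lemma exp_rem3_le {R : realType} (b0 b x : R) : 0 < b0 -> b0 <= b ->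
  exp_rem3 (b * x) / b ^+ 3 <= exp_rem3 (b0 * x) / b0 ^+ 3.
Proof.
move=> b0_gt0 b0b.
pose F (t : R) := exp_rem3 (t * x) / t ^+ 3.
pose F' (t : R) := ((t * x + 3) * expR (- (t * x)) -
  (3 - (t * x) *+ 2 + (t * x) ^+ 2 / 2)) / t ^+ 4.
have dF (t : R) : 0 < t -> is_derive t 1 F (F' t).
  move=> t_gt0; have t3 : t ^+ 3 != 0 by rewrite expf_neq0// gt_eqF.
  rewrite /F /F' /exp_rem3.
  have t0 : t != 0 by rewrite gt_eqF.
  apply: is_derive_eq; rewrite /GRing.scale /=.
  rewrite !(mulr0, mulr1, add0r, addr0, mul1r).
  by move: (expR _) => e; clear -t0; field.
have [c /[!in_itv]/= /andP[b0c cb] E] : exists2 c, c \in `[b0, b] &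
    F b - F b0 = F' c * (b - b0).
  apply: (MVT_segment b0b) => [t /[!in_itv]/= /andP[b0t _]|].
    by apply: dF; exact: lt_trans b0t.
  apply: continuous_in_subspaceT => t /[!inE]/= /[!in_itv]/= /andP[b0t _].
  apply/differentiable_continuous/derivable1_diffP.
  by have [] := dF t (lt_le_trans b0_gt0 b0t).
rewrite -/(F b) -/(F b0) -subr_le0 E mulr_le0_ge0 ?subr_ge0// /F'.
rewrite mulr_le0_ge0 ?subr_le0 ?expR_pade// invr_ge0 exprn_ge0//.
exact: le_trans (ltW b0_gt0) b0c.
Qed.

(** Serves to compute the pointwise limit of phi_b: after division by b^3 the error is of order b.
    The constant e^A is generous, Taylor's formula giving e^A / 24. *)
Lemma exp_rem3_approx {R : realType} (A y : R) : `|y| <= A ->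
  `|exp_rem3 y - y ^+ 3 / 6| <= expR A * y ^+ 4.
Proof.
move=> yA; have A0 : 0 <= A by rewrite (le_trans _ yA).
rewrite ler_norml -subr_ge0 opprK -[X in _ && X]subr_ge0.
have eA x : `|x| <= A -> expR (- x) <= expR A.
  by move=> xA; rewrite ler_expR (le_trans _ xA)// ler_normr lexx orbT.
have eA1 : 1 <= expR A by rewrite -expR0 ler_expR.
apply/andP; split.
  (* Lower bound: two rounds of the second-derivative criterion, ending with the fourth derivative
     24 e^A - e^(-x) >= 0 on |x| <= A. *)
  pose f (x : R) := exp_rem3 x - x ^+ 3 / 6 + expR A * x ^+ 4.
  pose f1 (x : R) := x - 1 + expR (- x) - x ^+ 2 / 2 + 4 * expR A * x ^+ 3.
  pose f2 (x : R) := 1 - expR (- x) - x + 12 * expR A * x ^+ 2.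
  pose f3 (x : R) := expR (- x) - 1 + 24 * expR A * x.
  pose f4 (x : R) := 24 * expR A - expR (- x).
  apply: (@second_derivative_ge0 _ f f1 f2 A) => //.
  - move=> x; rewrite /f /exp_rem3.
    by apply: is_derive_eq; rewrite /GRing.scale /f1 /=; field.
  - by move=> x; apply: is_derive_eq; rewrite /GRing.scale /f2 /=; field.
  - move=> x xA; apply: (@second_derivative_ge0 _ f2 f3 f4 A) => //.
    + by move=> z; apply: is_derive_eq; rewrite /GRing.scale /f3 /=; field.
    + by move=> z; apply: is_derive_eq; rewrite /GRing.scale /f4 /=; field.
    + by move=> z /eA; rewrite /f4; lra.
    + by rewrite /f2 oppr0 expR0; field.
    + by rewrite /f3 oppr0 expR0; field.
  - by rewrite /f /exp_rem3 oppr0 expR0; field.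
  - by rewrite /f1 oppr0 expR0; field.
(* Upper bound: one round suffices, because e^(-x) >= 1 - x. *)
pose f (x : R) := expR A * x ^+ 4 - (exp_rem3 x - x ^+ 3 / 6).
pose f1 (x : R) := 4 * expR A * x ^+ 3 - (x - 1 + expR (- x) - x ^+ 2 / 2).
pose f2 (x : R) := 12 * expR A * x ^+ 2 - (1 - expR (- x) - x).
apply: (@second_derivative_ge0 _ f f1 f2 A) => //.
- move=> x; rewrite /f /exp_rem3.
  by apply: is_derive_eq; rewrite /GRing.scale /f1 /=; field.
- by move=> x; apply: is_derive_eq; rewrite /GRing.scale /f2 /=; field.
- move=> x _; have := expR_ge1Dx (- x).
  have : 0 <= 12 * expR A * x ^+ 2.
    by rewrite mulr_ge0 ?sqr_ge0// mulr_ge0 ?expR_ge0.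
  rewrite /f2; lra.
- by rewrite /f /exp_rem3 oppr0 expR0; field.
- by rewrite /f1 oppr0 expR0; field.
Qed.

Local Open Scope ereal_scope.

(** * Integration against a measure that has a density *)

Section integral_density.
Import HBNNSimple.

(** For the simple functions [h n] this is linearity together with the hypothesis on sets; both
    sides then pass to the limit by monotone convergence. As [f] is real-valued, multiplication by
    [f x] preserves limits. *)
Lemma ge0_integral_density {d} {T : measurableType d} {R : realType}
    {P Q : {measure set T -> \bar R}} {f : T -> R} :
  measurable_fun [set: T] f -> (forall x, 0 <= f x)%R ->
  (forall A, measurable A -> P A = \int[Q]_(x in A) (f x)%:E) ->
  forall g : T -> \bar R, measurable_fun [set: T] g -> (forall x, 0 <= g x) ->
  \int[P]_x g x = \int[Q]_x (g x * (f x)%:E).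
Proof.
move=> mf f0 PE g mg g0.
have mEf : measurable_fun [set: T] (EFin \o f) by exact/measurable_EFinP.
pose h := nnsfun_approx measurableT mg.
have hg x : (h n x)%:E @[n --> \oo] --> g x.
  by apply: cvg_nnsfun_approx => // y _; exact: g0.
have hnd x : {homo (fun n => (h n x)%:E) : m n / (m <= n)%N >-> m <= n}.
  by move=> m n mn; rewrite lee_fin; exact/lefP/nd_nnsfun_approx.
have mh n : measurable_fun [set: T] (EFin \o h n).
  exact/measurable_EFinP/measurable_funP.
have h0 n x : 0 <= (h n x)%:E by rewrite lee_fin.
have hE n : \int[P]_x (h n x)%:E = \int[Q]_x ((h n x)%:E * (f x)%:E).
  have mhy y : measurable (h n @^-1` [set y]) by exact: measurable_sfunP.
  have mind y : measurable_fun [set: T]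
      (fun x => (\1_(h n @^-1` [set y]) x)%:E * (f x)%:E).
    apply: emeasurable_funM => //; exact/measurable_EFinP.
  rewrite integralT_nnsfun sintegralE.
  transitivity (\int[Q]_x \sum_(y \in range (h n))
      (y%:E * ((\1_(h n @^-1` [set y]) x)%:E * (f x)%:E))).
    rewrite ge0_integral_fsum//.
    - apply: eq_fsbigr => y /[!inE] -[z _ <-].
      rewrite ge0_integralZl ?lee_fin//; last first.
        by move=> x _; rewrite mule_ge0// lee_fin.
      congr *%E; rewrite PE// integral_mkcond; apply: eq_integral => x _.
      by rewrite epatch_indic muleC.
    - by move=> y; exact: measurable_funeM.
    - move=> y x _; rewrite muleA; apply: mule_ge0; last by rewrite lee_fin.
      by rewrite -EFinM; exact: nnfun_muleindic_ge0.
  apply: eq_integral => x _; rewrite [in RHS](fimfunE (h n) x) -fsumEFin//.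
  rewrite ge0_mule_fsuml//; last by move=> y; exact: nnfun_muleindic_ge0.
  by apply: eq_fsbigr => y _; rewrite EFinM muleA.
have cvgP : \int[P]_x (h n x)%:E @[n --> \oo] --> \int[P]_x g x.
  have -> : \int[P]_x g x = \int[P]_x limn (fun n => (h n x)%:E).
    by apply: eq_integral => x _; apply/esym/cvg_lim.
  exact: cvg_monotone_convergence.
have cvgQ : \int[P]_x (h n x)%:E @[n --> \oo] -->
    \int[Q]_x (g x * (f x)%:E).
  have -> : \int[Q]_x (g x * (f x)%:E) =
      \int[Q]_x limn (fun n => (h n x)%:E * (f x)%:E).
    by apply: eq_integral => x _; apply/esym/cvg_lim => //; exact: cvgeZr.
  under eq_fun do rewrite hE.
  apply: cvg_monotone_convergence => //.
  - by move=> n; apply: emeasurable_funM; [exact: mh|exact: mEf].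
  - by move=> n x _; rewrite mule_ge0// lee_fin.
  - by move=> x _ m n mn; apply: lee_wpmul2r; [rewrite lee_fin|exact: hnd].
by rewrite -(cvg_lim _ cvgP)// -(cvg_lim _ cvgQ).
Qed.

(** Multiplication by [f] >= 0 commutes with taking positive and negative parts, so the nonnegative
    case applies to each part. *)
Lemma integral_density {d} {T : measurableType d} {R : realType}
    {P Q : {measure set T -> \bar R}} {f X : T -> R} :
  measurable_fun [set: T] f -> (forall x, 0 <= f x)%R ->
  (forall A, measurable A -> P A = \int[Q]_(x in A) (f x)%:E) ->
  measurable_fun [set: T] X ->
  \int[P]_x (X x)%:E = \int[Q]_x (X x * f x)%:E.
Proof.
move=> mf f0 PE mX.
have mEX : measurable_fun [set: T] (EFin \o X) by exact/measurable_EFinP.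
rewrite integralE [RHS]integralE.
rewrite (ge0_integral_density mf f0 PE)//; last exact: measurable_funepos.
rewrite (ge0_integral_density mf f0 PE)//; last exact: measurable_funeneg.
congr (_ - _); apply: eq_integral => x _.
  by rewrite !funeposE maxe_pMl ?lee_fin// mul0e EFinM.
by rewrite !funenegE maxe_pMl ?lee_fin// mul0e EFinM mulNe.
Qed.

End integral_density.

(** * Young's inequality and a lower bound for the divergence *)

(** For t > 0, multiply 1 + (s - ln t) <= e^(s - ln t) by t; for t = 0 it reduces to e^s >= 0. *)
Lemma young_ln {R : realType} (s t : R) : (0 <= t ->
  s * t - (expR s - 1) <= t * ln t - t + 1)%R.
Proof.
rewrite le_eqVlt => /predU1P[<-|t0].
  by have := expR_ge0 s; lra.
have := ler_wpM2l (ltW t0) (expR_ge1Dx (s - ln t)%R).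
rewrite expRD expRN lnK ?posrE// mulrCA divff ?gt_eqF// mulr1.
by lra.
Qed.

Lemma div_integrand_ge0 {R : realType} (t : \bar R) : 0 <= div_integrand t.
Proof.
case: t => [t||]//=; rewrite lee_fin.
have [t0|t0] := leP 0%R t.
  by have := young_ln 0%R t t0; rewrite mul0r expR0; lra.
(* For t < 0 the convention ln t = 0 leaves the value 1 - t. *)
by rewrite ln0 ?(ltW t0)// mulr0; lra.
Qed.

Lemma measurable_div_integrand {R : realType} :
  measurable_fun [set: \bar R] (@div_integrand R).
Proof.
rewrite (_ : @div_integrand R = fun t => if t == +oo then +oo else
  if t == -oo then 0 else (fine t * ln (fine t) - fine t + 1)%R%:E); last first.
  by apply/funext => -[t||].
have mr : measurable_fun [set: R] (fun r : R => r * ln r - r + 1)%R.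
  apply: measurable_funD => //; apply: measurable_funB => //.
  by apply: measurable_funM => //; exact: measurable_ln.
apply: measurable_fun_ifT => //; first exact: measurable_fun_eqe.
apply: measurable_fun_ifT => //; first exact: measurable_fun_eqe.
apply/measurable_EFinP.
exact: (measurableT_comp mr (fine_measurable measurableT)).
Qed.

(** [young_ln] with s = g(x) and t = f(x), integrated against Q. *)
Lemma integral_le_div_integrand {d} {T : measurableType d} {R : realType}
    {P Q : {measure set T -> \bar R}} (f : T -> \bar R) (g : T -> R) :
  is_density P Q f -> measurable_fun [set: T] g ->
  \int[P]_x (g x)%:E \is a fin_num ->
  Q.-integrable [set: T] (EFin \o (fun x => expR (g x) - 1)%R) ->
  \int[P]_x (g x)%:E - \int[Q]_x (expR (g x) - 1)%:E <=
    \int[Q]_x div_integrand (f x).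
Proof.
move=> [mf f0 PE] mg Pg ig.
have mdiv h : measurable_fun [set: T] h ->
    measurable_fun [set: T] (fun x => div_integrand (h x : \bar R)).
  exact: measurableT_comp measurable_div_integrand.
have [Doo|] := boolP (\int[Q]_x div_integrand (f x) == +oo).
  by rewrite (eqP Doo) leey.
rewrite -ltey => Dfin.
have idiv : Q.-integrable [set: T] (fun x => div_integrand (f x)).
  apply/integrableP; split; first exact: mdiv.
  by under eq_integral do rewrite gee0_abs ?div_integrand_ge0//.
pose r x := fine (f x).
have mr : measurable_fun [set: T] r by exact: measurableT_comp mf.
have mEr : measurable_fun [set: T] (EFin \o r) by exact/measurable_EFinP.
have r0 x : (0 <= r x)%R by rewrite fine_ge0.
(* The integrand is +oo where f is, so a finite integral makes f finite almost everywhere, and [r]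
   is a real-valued density. *)
have fr : {ae Q, forall x, [set: T] x -> f x = (r x)%:E}.
  apply: filterS (integrable_ae measurableT idiv) => x /(_ Logic.I).
  by rewrite /r; move: (f0 x); case: (f x).
have PEr A : measurable A -> P A = \int[Q]_(x in A) (r x)%:E.
  move=> mA; rewrite PE//; apply: ge0_ae_eq_integral => //.
  - exact: measurable_funTS.
  - exact: measurable_funTS.
  - by move=> x _; rewrite lee_fin.
  - by apply: filterS fr => x + _; exact.
have Dr : \int[Q]_x div_integrand (f x) =
    \int[Q]_x (r x * ln (r x) - r x + 1)%R%:E.
  apply: ge0_ae_eq_integral => //.
  - exact: mdiv.
  - exact: (mdiv _ mEr).
  - by move=> x _; exact: div_integrand_ge0.
  - by move=> x _; exact: (div_integrand_ge0 (r x)%:E).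
  - by apply: filterS fr => x /[apply] ->.
have idivr : Q.-integrable [set: T]
    (EFin \o (fun x => r x * ln (r x) - r x + 1)%R).
  apply/integrableP; split; first exact: (mdiv _ mEr).
  under eq_integral do rewrite gee0_abs ?(div_integrand_ge0 (r _)%:E)//.
  by rewrite -Dr.
have gE := integral_density mr r0 PEr mg.
have igr : Q.-integrable [set: T] (EFin \o (fun x => g x * r x)%R).
  have mgr : measurable_fun [set: T] (fun x => g x * r x)%R.
    exact: measurable_funM.
  apply/integrableP; split; first exact/measurable_EFinP.
  by rewrite integral_fin_num_abs// -gE.
rewrite Dr gE -integralB_EFin//; apply: le_integral => //.
- exact: integrableB.
- by move=> x _; rewrite lee_fin young_ln.
Qed.

(** * The exponential integral near 0 *)

Lemma cvg_exp_rem3 {R : realType} (b x : R) : (0 < b)%R ->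
  (fun n : nat => exp_rem3 (b / n.+1%:R * x) / (b / n.+1%:R) ^+ 3)%R @ \oo -->
    (x ^+ 3 / 6)%R.
Proof.
move=> b_gt0; set c := fun n : nat => (b / n.+1%:R)%R.
have c_gt0 n : (0 < c n)%R by rewrite divr_gt0// ltr0n.
have cvgc : c @ \oo --> (0 : R)%R.
  by rewrite -(mulr0 b); apply: cvgMr; exact: cvg_harmonic.
(* [exp_rem3_approx] at y = c_n x with A = b |x|, divided by c_n^3, bounds the error by c_n K. *)
pose K := (expR (b * `|x|) * x ^+ 4)%R.
have cK : (fun n => c n * K)%R @ \oo --> (0 : R)%R.
  by rewrite -(mul0r K); exact: cvgMl.
pose g n := (exp_rem3 (c n * x) / c n ^+ 3)%R.
have gK n : (0 <= `|g n - x ^+ 3 / 6| <= c n * K)%R.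
  rewrite normr_ge0/=.
  have cnx : (`|c n * x| <= b * `|x|)%R.
    rewrite normrM gtr0_norm// ler_wpM2r//.
    by rewrite ler_pdivrMr ?ltr0n// ler_peMr ?ler1n// ltW.
  have c3 : (0 < c n ^+ 3)%R by rewrite exprn_gt0.
  rewrite -(ler_pM2r c3) -{1}(gtr0_norm c3) -normrM mulrBl /g divfK ?gt_eqF//.
  have -> : (x ^+ 3 / 6 * c n ^+ 3 = (c n * x) ^+ 3 / 6)%R by field.
  have -> : (c n * K * c n ^+ 3 = expR (b * `|x|) * (c n * x) ^+ 4)%R.
    by rewrite /K; ring.
  exact: exp_rem3_approx.
have gl : (fun n => `|g n - x ^+ 3 / 6|)%R @ \oo --> (0 : R)%R.
  apply: (@squeeze_cvgr _ _ _ _ (fun=> 0%R) (fun n => c n * K)%R) => //.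
  - exact: nearW.
  - exact: cvg_cst.
apply/subr_cvg0; apply: norm_cvg0; exact: gl.
Qed.

(** As E(X) = 0 and E(X^2) = 1, the integral of e^(t X) - 1 is t^2 / 2 minus (-t)^3 times that of
    phi_(-t)(X). Since phi_b grows as b decreases, a single b at which the integral of phi_b(X) is
    nonnegative serves for all smaller ones. *)
Lemma integral_expR_le {d} {T : measurableType d} {R : realType}
    {Q : {measure set T -> \bar R}} {X : T -> R} {beta : R} :
  measurable_fun [set: T] X ->
  \int[Q]_x (X x)%:E = 0 -> \int[Q]_x ((X x) ^+ 2)%R%:E = 1 ->
  0 < \int[Q]_x ((X x) ^+ 3)%R%:E ->
  (beta < 0)%R -> \int[Q]_x (expR (beta * X x))%:E < +oo ->
  Q [set: T] < +oo /\
  exists b0 : R, (0 < b0)%R /\ forall t : R, (- b0 <= t <= 0)%R ->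
    Q.-integrable [set: T] (EFin \o (fun x => expR (t * X x) - 1)%R) /\
    \int[Q]_x (expR (t * X x) - 1)%:E <= (t ^+ 2 / 2)%:E.
Proof.
move=> mX X1 X2 X3 beta0 Zfin.
(* The integral is the difference of those of the two parts, and oo - oo is infinite, so a finite
   value gives integrability. *)
have int_of (h : T -> R) : measurable_fun [set: T] h ->
    \int[Q]_x (h x)%:E \is a fin_num -> Q.-integrable [set: T] (EFin \o h).
  move=> mh hfin; apply/integrableP; split; first exact/measurable_EFinP.
  by rewrite integral_fin_num_abs.
have intD (f g : T -> R) : Q.-integrable [set: T] (EFin \o f) ->
    Q.-integrable [set: T] (EFin \o g) ->
    Q.-integrable [set: T] (EFin \o (fun x => f x + g x)%R).
  exact: integrableD.
have intB (f g : T -> R) : Q.-integrable [set: T] (EFin \o f) ->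
    Q.-integrable [set: T] (EFin \o g) ->
    Q.-integrable [set: T] (EFin \o (fun x => f x - g x)%R).
  exact: integrableB.
have intZ k (f : T -> R) : Q.-integrable [set: T] (EFin \o f) ->
    Q.-integrable [set: T] (EFin \o (fun x => k * f x)%R).
  exact: integrableZl.
have mexp t : measurable_fun [set: T] (fun x => expR (t * X x)).
  by apply: measurableT_comp => //; exact: measurable_funM.
have iX : Q.-integrable [set: T] (EFin \o X) by apply: int_of => //; rewrite X1.
have mX2 : measurable_fun [set: T] (fun x => X x ^+ 2)%R.
  exact: measurable_funX.
have mX3 : measurable_fun [set: T] (fun x => X x ^+ 3)%R.
  exact: measurable_funX.
have iX2 : Q.-integrable [set: T] (EFin \o (fun x => X x ^+ 2)%R).
  by apply: int_of => //; rewrite X2.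
have iexpb : Q.-integrable [set: T] (EFin \o (fun x => expR (beta * X x))).
  apply/integrableP; split; first exact/measurable_EFinP.
  by under eq_integral do rewrite /= ger0_norm ?expR_ge0//.
(* A finite exponential moment together with E(X^2) < +oo makes Q finite. *)
have i1 : Q.-integrable [set: T] (EFin \o cst 1%R).
  pose g x := (expR (- beta) * expR (beta * X x) + X x ^+ 2)%R.
  apply: (@le_integrable _ _ _ _ _ measurableT _ (EFin \o g)).
  - exact/measurable_EFinP.
  - move=> x _; rewrite /g/= lee_fin normr1 ler_normr; apply/orP; left.
    (* [g] dominates 1: its first term is e^(beta (X - 1)) >= 1 when X <= 1, and X^2 >= 1
       otherwise. *)
    have [X1x|/ltW X1x] := leP (X x) 1%R.
      rewrite -expRD -[leLHS]addr0 lerD ?sqr_ge0// -expR0 ler_expR.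
      by rewrite addrC -{2}(mulr1 beta) -mulrBr mulr_le0// ?subr_le0// ltW.
    rewrite -[leLHS]add0r lerD ?mulr_ge0 ?expR_ge0// expr_ge1//.
    exact: le_trans X1x.
  - by apply: intD iX2; exact: intZ.
have Qfin : Q [set: T] < +oo.
  have : \int[Q]_x cst 1%:E x < +oo by have := integrable_lty measurableT i1.
  by rewrite integral_cst// mul1e.
split => //.
have iexp t : (beta <= t <= 0)%R ->
    Q.-integrable [set: T] (EFin \o (fun x => expR (t * X x))).
  move=> /andP[bt t0].
  apply: (@le_integrable _ _ _ _ _ measurableT _
    (EFin \o (fun x => 1 + expR (beta * X x))%R)).
  - exact/measurable_EFinP.
  - move=> x _; rewrite /= lee_fin !ger0_norm ?addr_ge0 ?expR_ge0//.
    (* e^(t X) is at most 1 when X >= 0 and at most e^(beta X) when X < 0. *)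
    have [x0|/ltW x0] := leP 0%R (X x).
      by rewrite -[leLHS]addr0 lerD ?expR_ge0// -expR0 ler_expR mulr_le0_ge0.
    by rewrite -[leLHS]add0r lerD// ler_expR ler_wnM2r.
  - exact: intD i1 iexpb.
pose F (b : R) x := (exp_rem3 (b * X x) / b ^+ 3)%R.
have FE b x : (0 < b)%R ->
    (b ^+ 3 * F b x = 1 - b * X x + b ^+ 2 / 2 * X x ^+ 2 - expR (- b * X x))%R.
  move=> b0; rewrite /F mulrCA mulfV ?mulr1 ?expf_neq0 ?gt_eqF//.
  by rewrite /exp_rem3 exprMn mulrAC mulNr.
have iF b : (0 < b)%R -> (b <= - beta)%R ->
    Q.-integrable [set: T] (EFin \o F b).
  move=> b0 bb.
  have -> : F b = fun x => (b ^- 3 *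
      (1 - b * X x + b ^+ 2 / 2 * X x ^+ 2 - expR (- b * X x)))%R.
    by apply/funext => x; rewrite -FE// mulKf// expf_neq0// gt_eqF.
  apply/intZ; apply/intB.
    by apply/intD; [apply: (intB (cst 1%R))|] => //; exact: intZ.
  by apply: iexp; rewrite oppr_le0 (ltW b0) lerNr bb.
have F_le a b x : (0 < a)%R -> (a <= b)%R -> (F b x <= F a x)%R.
  exact: exp_rem3_le.
have beta'0 : (0 < - beta)%R by rewrite oppr_gt0.
(* A sequence decreasing to 0 from c_0 = - beta, hence within the range where [F] is integrable. *)
pose c n : R := (- beta / n.+1%:R)%R.
have c0 n : (0 < c n)%R by rewrite divr_gt0.
have cbeta n : (c n <= - beta)%R.
  by rewrite ler_pdivrMr ?ltr0n// ler_peMr ?ler1n// ltW.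
(* Arguing by contradiction covers an infinite E(X^3) as well: integrals that all stay nonpositive
   would force X^3 to be integrable with E(X^3) <= 0. *)
have [n Fn] : exists n, 0 <= \int[Q]_x (F (c n) x)%:E.
  apply: contrapT => /forallNP FN.
  have Fle0 n : \int[Q]_x (F (c n) x)%:E <= 0.
    by rewrite leNgt; apply/negP => /ltW; exact: FN.
  have i0 := iF _ beta'0 (lexx _).
  (* Subtracting the first term makes the sequence nonnegative, as monotone convergence requires. *)
  pose u n x := (F (c n) x - F (- beta) x)%:E.
  have iu n : \int[Q]_x u n x <= - \int[Q]_x (F (- beta) x)%:E.
    rewrite /u; under eq_integral do rewrite EFinB.
    rewrite integralB_EFin//; last exact: iF.
    by rewrite -[leRHS]add0e leeB.
  have limu x : limn (u ^~ x) = (X x ^+ 3 / 6 - F (- beta) x)%:E.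
    apply/cvg_lim => //; apply: cvg_EFin; first exact: nearW.
    apply: cvgB; last exact: cvg_cst.
    exact: cvg_exp_rem3.
  have u0 n x : 0 <= u n x by rewrite lee_fin subr_ge0 F_le.
  have mu n : measurable_fun [set: T] (u n).
    by have /measurable_int := intB _ _ (iF _ (c0 n) (cbeta n)) i0.
  have ndu x : nondecreasing_seq (u ^~ x).
    move=> m k mk; rewrite lee_fin lerB// F_le//.
    by rewrite ler_pM2l// lef_pV2 ?posrE ?ltr0n// ler_nat.
  have lim_le : \int[Q]_x (X x ^+ 3 / 6 - F (- beta) x)%:E <=
      - \int[Q]_x (F (- beta) x)%:E.
    under eq_integral do rewrite -limu.
    rewrite monotone_convergence//; apply: lime_le; last exact: nearW.
    apply: ereal_nondecreasing_is_cvgn => m k mk.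
    by apply: ge0_le_integral => // x _; exact: ndu.
  have i0fin := integrable_fin_num measurableT i0.
  have idiff : Q.-integrable [set: T]
      (EFin \o (fun x => X x ^+ 3 / 6 - F (- beta) x)%R).
    apply/integrableP; split.
      apply/measurable_EFinP; apply: measurable_funB.
        exact: measurable_funM.
      by apply/measurable_EFinP; exact: measurable_int i0.
    under eq_integral => x _.
      rewrite /= ger0_norm; last first.
        rewrite -lee_fin -limu; apply: lime_ge; last exact: nearW.
        by apply: ereal_nondecreasing_is_cvgn; exact: ndu.
      over.
    by rewrite (le_lt_trans lim_le)// ltey_eq fin_numN i0fin.
  have iX3 : Q.-integrable [set: T] (EFin \o (fun x => X x ^+ 3)%R).
    have -> : (fun x => X x ^+ 3)%R =
        (fun x => 6 * ((X x ^+ 3 / 6 - F (- beta) x) + F (- beta) x))%R.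
      by apply/funext => x; rewrite subrK; field.
    by apply/intZ; apply/intD.
  (* With X^3 integrable, the finite integral of [F (- beta)] cancels and leaves E(X^3) / 6 <= 0. *)
  move: lim_le; under eq_integral do rewrite EFinB.
  rewrite integralB_EFin//; last first.
    have -> : (fun x => X x ^+ 3 / 6)%R = (fun x => 6^-1 * X x ^+ 3)%R.
      by apply/funext => x; rewrite mulrC.
    exact: intZ.
  rewrite -[leRHS]add0e leeD2rE ?fin_numN//.
  under eq_integral do rewrite mulrC EFinM.
  rewrite integralZl// pmule_rle0 ?lte_fin ?invr_gt0//.
  by rewrite leNgt X3.
exists (c n); split => // t /andP[ct t0].
have itexp : Q.-integrable [set: T] (EFin \o (fun x => expR (t * X x))).
  by apply: iexp; rewrite t0 andbT (le_trans _ ct)// lerNr.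
split; first exact: intB itexp i1.
(* t = 0 is treated apart because [F (- t)] divides by (-t)^3. *)
have [->|tN0] := eqVneq t 0%R.
  under eq_integral do rewrite mul0r expR0 subrr.
  by rewrite integral0 lee_fin expr0n mul0r.
have {}t0 : (0 < - t)%R by rewrite oppr_gt0 lt_neqAle tN0.
have tb : (- t <= - beta)%R by rewrite (le_trans _ (cbeta n))// lerNl.
have iFt := iF _ t0 tb.
have Ft : 0 <= \int[Q]_x (F (- t) x)%:E.
  apply: (le_trans Fn); apply: le_integral => //; first exact: iF.
  by move=> x _; rewrite lee_fin F_le// lerNl.
have expE x : (expR (t * X x) - 1 =
    (t * X x + t ^+ 2 / 2 * X x ^+ 2) - (- t) ^+ 3 * F (- t) x)%R.
  by rewrite FE// opprK sqrrN; ring.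
under eq_integral do rewrite expE EFinB.
rewrite integralB_EFin//; last 2 first.
- by apply/intD; exact: intZ.
- exact: intZ.
under eq_integral do rewrite EFinD.
rewrite integralD_EFin//; [|exact: intZ..].
under eq_integral do rewrite /= EFinM.
rewrite integralZl// X1 mule0 add0e.
under eq_integral do rewrite /= EFinM.
rewrite integralZl// X2 mule1.
under eq_integral do rewrite /= EFinM.
by rewrite integralZl// -[leRHS]sube0 leeB// mule_ge0// lee_fin exprn_ge0// ltW.
Qed.

(** * The choice of [eps] and the final inequality *)

Theorem theorem9 (d : measure_display) (T : measurableType d) (R : realType)
    (Q : {measure set T -> \bar R}) (X : {mfun T >-> R})
    (X_mean : \int[Q]_x (X x)%:E = 0)
    (X_var : \int[Q]_x ((X x) ^+ 2)%R%:E = 1)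
    (X_skew : 0 < \int[Q]_x ((X x) ^+ 3)%R%:E)
    (Z_fin : exists beta : R, (beta < 0)%R /\
       \int[Q]_x (expR (beta * X x))%:E < +oo) :
  exists eps : R, (0 < eps)%R /\
    forall P : {measure set T -> \bar R},
      (- eps)%:E <= \int[P]_x (X x)%:E <= 0 ->
      (2^-1)%:E * (\int[P]_x (X x)%:E) ^+ 2 <= divergence P Q.
Proof.
have [beta [beta0 Zfin]] := Z_fin.
have mX : measurable_fun [set: T] X by exact: measurable_funPT.
have [Qfin [b0 [b0_gt0 expX]]] :=
  integral_expR_le mX X_mean X_var X_skew beta0 Zfin.
(* A null measure would give E(X^2) = 0. *)
have Q_gt0 : 0 < Q [set: T].
  rewrite lt0e measure_ge0 andbT; apply/eqP => Q0.
  move: X_var; rewrite null_set_integral//.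
  - by move/eqP; rewrite eq_sym onee_eq0.
  - by apply/measurable_EFinP; exact: measurable_funX.
have Qfn : Q [set: T] \is a fin_num by rewrite ge0_fin_numE.
(* [b0] keeps m in the range of the exponential bound; 1 and Q(T) give eps^2 <= eps <= Q(T). *)
pose eps : R := Num.min b0 (Num.min 1%R (fine (Q [set: T]))).
have eps_gt0 : (0 < eps)%R.
  by rewrite !lt_min b0_gt0 ltr01 fine_gt0// Q_gt0.
exists eps; split=> // P /andP[epsP P0].
have Pfin : \int[P]_x (X x)%:E \is a fin_num.
  by rewrite fin_numElt (lt_le_trans _ epsP) ?ltNyr// (le_lt_trans P0).
set m := fine (\int[P]_x (X x)%:E).
have PE : \int[P]_x (X x)%:E = m%:E by rewrite fineK.
move: epsP P0; rewrite PE !lee_fin => epsm m0.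
have mb0 : (- b0 <= m <= 0)%R.
  by rewrite m0 andbT (le_trans _ epsm)// lerN2 ge_min lexx.
have [iexp exp_le] := expX _ mb0.
rewrite /divergence; case: asboolP => [PQ|_]; last exact: leey.
rewrite /density; case: xgetP => [f _ Pf|_].
  have mXm : measurable_fun [set: T] (fun x => m * X x)%R.
    exact: measurable_funM.
  have PmX : \int[P]_x (m * X x)%:E = (m ^+ 2)%:E.
    under eq_integral do rewrite EFinM.
    rewrite integralZl//; first by rewrite PE -EFinM expr2.
    apply/integrableP; split; first exact/measurable_EFinP.
    by rewrite integral_fin_num_abs.
  (* The bound reads m^2 minus the integral of e^(m X) - 1, which is at most m^2 / 2. *)
  have := integral_le_div_integrand f (fun x => m * X x)%R Pf mXm.
  rewrite PmX => /(_ isT iexp); apply: le_trans.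
  rewrite -EFin_expe -EFinM.
  apply: (@le_trans _ _ ((m ^+ 2)%:E - (m ^+ 2 / 2)%:E)); last by rewrite leeB.
  by rewrite -EFinB lee_fin; lra.
(* Without a density [density P Q] is 0 and the divergence is Q(T), which
   dominates eps^2 / 2 by the choice of eps; Radon-Nikodym is not needed. *)
rewrite (_ : (fun x => _) = cst 1); last first.
  by apply/funext => x; rewrite /= mul0r subr0 add0r.
rewrite integral_cst// mul1e -(fineK Qfn) -EFin_expe -EFinM lee_fin.
have : (eps <= 1)%R by rewrite !ge_min lexx orbT.
have : (eps <= fine (Q [set: T]))%R by rewrite !ge_min lexx !orbT.
move: epsm m0 eps_gt0; set e := eps; set q := fine _ => H1 H2 H3 H4 H5.
nra.
Qed.
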